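(* Let $E$ be a real Banach space and let $f\colon E\to\mathbb{R}$ be a continuous and Gâteaux-differentiable function such that $f'\colon E\to E^*$ is continuous from the norm topology of $E$ to the weak$^*$-topology of $E^*$. Take two distinct points $u_0,u_1\in E$ and define $$\Gamma=\{c\in C([0,1];E)\mid c(0)=u_0,\ c(1)=u_1\},\qquad d=\inf_{c\in\Gamma}\ \sup_{0\le t\le 1} f(c(t)).$$ Assume that $f$ satisfies condition (C) at the level $d$. If $$d>\max\{f(u_0),f(u_1)\},$$ then there is a $\bar u\in \mathrm{Cr}(f,d)$ such that (a) $u_0\xrightarrow[f]{}\bar u$; (b) either $\bar u$ is a mountain-pass point, or $\bar u\in \mathrm{cl}(M)\setminus M$, where $M=M(f,d)$.
   Context: Condition (C) at the level $d$: every sequence $x_n$ in $E$ such that $f(x_n)\to d$ and $(1+\|x_n\|)\|f'(x_n)\|_*\to 0$ as $n\to+\infty$ (where $\|\cdot\|_*$ is the operator norm on $E^*$) has a convergent subsequence, which converges to a critical point $\bar x$ of $f$ with $f(\bar x)=d$. $\mathrm{Cr}(f,d)=\{u\in E: f(u)=d \text{ and } f'(u)=0\}$. $M(f,d)=\{u\in \mathrm{Cr}(f,d): u \text{ is a local minimum for } f\}$. $\mathrm{cl}(S)$ is the closure of $S\subset E$. A critical point $\bar u$ of $f$ is a mountain-pass point if, for every open neighborhood $\mathcal U$ of $\bar u$ in $E$, the set $\{u\in\mathcal U\mid f(u)<f(\bar u)\}$ is neither empty nor path connected. Put $\dot f^d=\{u\in E: f(u)<d\}$. For $e\in\dot f^d$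 and $u\in \mathrm{Cr}(f,d)$, write $e\xrightarrow[f]{}u$ if $u\in \mathrm{cl}(A)$, where $A$ is the path component of $e$ in $\dot f^d$. *)

(* Defs.v *)
From HB Require Import structures.
From mathcomp Require Import all_boot all_order all_algebra.
From mathcomp Require Import all_classical all_reals all_analysis.

Set Implicit Arguments.
Unset Strict Implicit.
Unset Printing Implicit Defensive.

Import Order.TTheory GRing.Theory Num.Theory.
Import numFieldNormedType.Exports.

Local Open Scope classical_set_scope.
Local Open Scope ring_scope.

(** * The topological dual [E^*] *)

Record dual (R : realType) (E : normedModType R) := Dual {
  dual_fun :> {scalar E};
  dual_continuous : continuous (dual_fun : E -> R) }.

HB.instance Definition _ (R : realType) (E : normedModType R) :=
  gen_eqMixin (dual E).
HB.instance Definition _ (R : realType) (E : normedModType R) :=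
  gen_choiceMixin (dual E).

(** [E^*] with its weak-star topology, that is, the topology of pointwise
    convergence on [E]. *)
Definition weak_star_dual (R : realType) (E : normedModType R) :=
  initial_topology (fun phi : dual E => (phi : E -> R) : {ptws E -> R}).

HB.instance Definition _ (R : realType) (E : normedModType R) :=
  Topological.on (weak_star_dual E).

Definition dual_norm (R : realType) (E : normedModType R) (phi : dual E) : R :=
  sup [set `|phi v| | v in [set v : E | `|v| <= 1]].

(** * Gateaux derivatives and critical points *)

(** The Gateaux derivative of [f] at [x] is a bounded linear functional whose
    value at [v] is the two-sided limit of [(f (x + h *: v) - f x) / h]. *)
Definition gateaux_derivative (R : realType) (E : normedModType R)
    (f : E -> R) (f' : E -> dual E) : Prop :=
  forall x v : E, is_derive x v f (f' x v).

Definition critical_point (R : realType) (E : normedModType R)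
    (f' : E -> dual E) (u : E) : Prop :=
  forall v : E, f' u v = 0.

Definition Cr (R : realType) (E : normedModType R)
    (f : E -> R) (f' : E -> dual E) (d : R) : set E :=
  [set u | f u = d /\ critical_point f' u].

Definition local_minimum (R : realType) (E : normedModType R)
    (f : E -> R) (u : E) : Prop :=
  \forall v \near u, f u <= f v.

Definition Mmin (R : realType) (E : normedModType R)
    (f : E -> R) (f' : E -> dual E) (d : R) : set E :=
  [set u | Cr f f' d u /\ local_minimum f u].

Definition conditionC (R : realType) (E : normedModType R)
    (f : E -> R) (f' : E -> dual E) (d : R) : Prop :=
  forall x : nat -> E,
    f (x n) @[n --> \oo] --> d ->
    (1 + `|x n|) * dual_norm (f' (x n)) @[n --> \oo] --> (0 : R) ->
    exists s : nat -> nat, increasing_seq s /\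
      exists2 xbar : E, x (s n) @[n --> \oo] --> xbar & Cr f f' d xbar.

(** * Paths and path components *)

(** An element of [C([0,1]; E)] is represented by a function on [R] of which only
    the restriction to [[0,1]] matters. *)
Definition paths (R : realType) (E : normedModType R) (x y : E) : set (R -> E) :=
  [set c : R -> E | [/\ {within `[0, 1], continuous c}, c 0 = x & c 1 = y]].

Definition joined_in (R : realType) (E : normedModType R)
    (A : set E) (x y : E) : Prop :=
  exists2 c : R -> E, paths x y c & c @` `[0, 1] `<=` A.

Definition path_connected (R : realType) (E : normedModType R)
    (A : set E) : Prop :=
  forall x y : E, A x -> A y -> joined_in A x y.

Definition path_component (R : realType) (E : normedModType R)
    (A : set E) (e : E) : set E :=
  [set x | joined_in A e x].

Definition sublevel (R : realType) (E : normedModType R)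
    (f : E -> R) (d : R) : set E := [set u | f u < d].

Definition reaches (R : realType) (E : normedModType R)
    (f : E -> R) (d : R) (e u : E) : Prop :=
  closure (path_component (sublevel f d) e) u.

Definition mountain_pass_point (R : realType) (E : normedModType R)
    (f : E -> R) (f' : E -> dual E) (u : E) : Prop :=
  critical_point f' u /\
  forall U : set E, open U -> U u ->
    U `&` sublevel f (f u) !=set0 /\ ~ path_connected (U `&` sublevel f (f u)).

(** For continuous [f], the supremum and the infimum below are those of nonempty
    bounded sets, so that [sup] and [inf] do not take their default value. *)
Definition minimax_level (R : realType) (E : normedModType R)
    (f : E -> R) (u0 u1 : E) : R :=
  inf [set sup [set f (c t) | t in `[0, 1]] | c in paths u0 u1].

(* Main.v *)
Require Import Defs.
From HB Require Import structures.
From mathcomp Require Import all_boot all_order all_algebra.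
From mathcomp Require Import all_classical all_reals all_analysis.
From mathcomp Require Import finmap lra ring.

Import Order.TTheory GRing.Theory Num.Theory.
Import numFieldNormedType.Exports.

Local Open Scope classical_set_scope.
Local Open Scope ring_scope.

(** The proof combines a separation form of the mountain-pass theorem with a
    short topological argument.

    Separation theorem ([minimax_separation]): if a closed set [F] meets every
    path from [u0] to [u1] and [f >= d] on [F], where [d] is the minimax level,
    then [F] contains a critical point at level [d].  Otherwise condition (C)
    gives some [e > 0] such that, at every [x] with [|f x - d| <= e] that has a
    point of [F] within [e (1 + |x|)], there is a direction of size at most
    [(1 + |x|) / 2] along which the derivative is less than [- 2 e]
    ([uniform_descent]).  A path on which [f] is almost at most [d] is then
    pushed down near [F] until [f < d] wherever it meets [F], a contradiction
    ([deformation]).  No differential equation is solved.  Each small step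
    follows a convex combination of finitely many directions ([descent_field]),
    for which the continuity of [f'] into the weak-star topology suffices, and
    the steps are continued up to a fixed total time by a maximality argument
    ([exhaustion]), which applies because [E] is complete.  The weight [1 + |x|]
    of condition (C) is carried by the relation [within_cost], whose transitivity
    plays the role of the triangle inequality for the geodesic distance.

    Topological argument: let [A] be the path component of [u0] in [{f < d}], let
    [K] be the set of the critical points at level [d] in [cl A], and suppose
    that no point of [K] satisfies (b).  Then each point of [K] has a
    neighbourhood [U] on which [f > f u1], that contains no point of [M] and
    satisfies [U /\ {f < d} <= A].  With [W] the union of these neighbourhoods,
    normality of [E] gives an open [N] with [K <= N <= cl N <= W].  The boundary
    of [A \/ N] separates [u0] from [u1] and [f >= d] there, so it contains a
    critical point [x] at level [d].  It does not belong to [cl A], since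
    [K <= N]; hence it belongs to [cl N <= W], and [f >= d] near [x].  Thus [x] is
    a local minimum lying in [W], which is impossible. *)

(** * Uniform descent away from the critical set *)

Lemma weak_star_continuous_eval {R : realType} {E : normedModType R}
    {f' : E -> dual E} (v : E) :
  continuous (f' : E -> weak_star_dual E) -> continuous (fun x => f' x v : R).
Proof.
move=> cf' x.
have cphi := @initial_continuous (dual E) _
  (fun phi : dual E => (phi : E -> R) : {ptws E -> R}).
have ceval := @proj_continuous E (fun=> R) v.
exact: (@continuous_comp _ _ _ (fun x : E => (f' x : weak_star_dual E))
  (fun phi : weak_star_dual E => (phi v : R)) x (cf' x)
  (@continuous_comp (weak_star_dual E) {ptws E -> R} R
    (fun phi : dual E => (phi : E -> R)) (fun g => g v) _ (cphi _) (ceval _))).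
Qed.

(** No bound on [phi] is needed: the supremum of an unbounded set is [0]. *)
Lemma dual_norm_ge0 {R : realType} {E : normedModType R} (phi : dual E) :
  0 <= dual_norm phi.
Proof.
rewrite /dual_norm.
set S := [set _ | _ in _].
have [supS|/sup_out -> //] := pselect (has_sup S).
by apply: (sup_upper_bound supS); exists 0 => /=; rewrite ?normr0// raddf0 normr0.
Qed.

Lemma dual_norm_le {R : realType} {E : normedModType R} (phi : dual E) {b : R} :
  (forall v, `|v| <= 1 -> `|phi v| <= b) -> dual_norm phi <= b.
Proof.
move=> phib; apply: ge_sup => [|_ [v v1 <-]]; last exact: phib.
by exists `|phi 0|, 0 => //=; rewrite normr0.
Qed.

Lemma increasing_seq_geid {s : nat -> nat} : increasing_seq s ->
  forall n, (n <= s n)%N.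
Proof.
move=> incs; elim=> // n IH; apply: (leq_ltn_trans IH).
have := incs n.+1 n; rewrite /Order.le/= => h.
by rewrite ltnNge h ltnn.
Qed.

(** This is the only use of condition (C).  The weight in the distance to [F]
    causes no loss, because the points produced by condition (C) converge and are
    therefore bounded.  The upper bound [e0] allows [eps] to be taken as small as
    needed. *)
Lemma uniform_descent {R : realType} {E : normedModType R}
    {f : E -> R} {f' : E -> dual E} {d : R} {F : set E} {e0 : R} :
  conditionC f f' d -> closed F -> (forall x, F x -> ~ Cr f f' d x) -> 0 < e0 ->
  exists2 eps : R, 0 < eps <= e0 &
    forall x z, `|f x - d| <= eps -> F z -> `|z - x| <= eps * (1 + `|x|) ->
      exists2 h, `|h| <= (1 + `|x|) / 2 & f' x h < - (2 * eps).
Proof.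
move=> fC clF noCr e0_gt0; apply: contrapT => nex.
pose eps n : R := Num.min e0 n.+1%:R^-1.
have eps_gt0 n : 0 < eps n by rewrite /eps lt_min e0_gt0 invr_gt0 ltr0n.
have epsV n : eps n <= n.+1%:R^-1 by rewrite /eps ge_min lexx orbT.
have eps0 : eps n @[n --> \oo] --> (0 : R).
  apply: (@squeeze_cvgr _ _ _ _ (fun=> 0) (fun n => n.+1%:R^-1)) => //.
  - by apply: nearW => n; rewrite epsV ltW.
  - exact: cvg_cst.
  - exact: cvg_harmonic.
have bad n : exists p : E * E, [/\ `|f p.1 - d| <= eps n, F p.2,
    `|p.2 - p.1| <= eps n * (1 + `|p.1|) &
    (1 + `|p.1|) * dual_norm (f' p.1) <= 4 * eps n].
  apply: contrapT => nobad; apply: nex; exists (eps n).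
    by rewrite eps_gt0/= ge_min lexx.
  move=> x z fx Fz zx; apply: contrapT => nodesc; apply: nobad.
  exists (x, z); split => //=.
  have x1 : 0 < 1 + `|x| by rewrite ltr_pwDl.
  rewrite mulrC -ler_pdivlMr //.
  suff bnd : forall v, `|v| <= 1 -> `|f' x v| <= 4 * eps n / (1 + `|x|).
    exact: dual_norm_le bnd.
  (* the sign is immaterial, since [- v] is allowed whenever [v] is *)
  have half v : `|v| <= 1 -> - f' x v <= 4 * eps n / (1 + `|x|).
    move=> v1; rewrite leNgt; apply/negP => lt; apply: nodesc.
    exists (((1 + `|x|) / 2) *: v).
      rewrite normrZ ger0_norm; last by rewrite divr_ge0 // ltW.
      by rewrite ler_piMr // divr_ge0 // ltW.
    rewrite linearZ /=; rewrite ltr_pdivrMr // in lt.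
    rewrite /GRing.scale/=; lra.
  move=> v v1; rewrite ler_norml lerNl half //=.
  by have := half (- v); rewrite normrN raddfN opprK; exact.
have [p pP] := choice bad.
have [||s [incs [xbar xs Crx]]] := fC (fun n => (p n).1).
- apply/cvgrPdist_le => e e_gt0; near=> n.
  rewrite distrC; have [h _ _ _] := pP n; apply: le_trans h _.
  near: n; have /cvgrPdist_le /(_ e e_gt0) := eps0.
  apply: filterS => n; rewrite sub0r normrN; exact: le_trans (ler_norm _).
- have lim4 : 4 * eps n @[n --> \oo] --> (0 : R).
    by rewrite -(mulr0 4); apply: cvgMr.
  apply: (@squeeze_cvgr _ _ _ _ (fun=> 0) (fun n => 4 * eps n)) => //.
    apply: nearW => n; have [_ _ _ ->] := pP n; rewrite andbT.
    by rewrite mulr_ge0 ?dual_norm_ge0 // addr_ge0.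
  exact: cvg_cst.
have epss0 : eps (s n) @[n --> \oo] --> (0 : R).
  apply: (@squeeze_cvgr _ _ _ _ (fun=> 0) (fun n => n.+1%:R^-1)).
  - apply: nearW => n; rewrite ltW //=; apply: le_trans (epsV _) _.
    by rewrite lef_pV2 ?posrE ?ltr0n // ler_nat ltnS increasing_seq_geid.
  - exact: cvg_cst.
  - exact: cvg_harmonic.
suff: F xbar by move=> Fx; exact: (noCr xbar Fx).
apply: (@closed_cvg _ _ \oo _ (fun n => (p (s n)).2)) => //.
  by apply: nearW => n; have [_ Fz _ _] := pP (s n).
have -> : (fun n => (p (s n)).2) =
    (fun n => (p (s n)).1 + ((p (s n)).2 - (p (s n)).1)).
  by apply/funext => n; rewrite addrC subrK.
rewrite -[X in _ --> X]addr0; apply: cvgD => //.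
apply/norm_cvg0P.
apply: (@squeeze_cvgr _ _ _ _ (fun=> 0)
  (fun n => eps (s n) * (1 + `|(p (s n)).1|))).
- by apply: nearW => n; have [_ _ + _] := pP (s n); rewrite normr_ge0.
- exact: cvg_cst.
- rewrite -(mul0r (1 + `|xbar|)); apply: cvgM => //.
  by apply: cvgD; [exact: cvg_cst|exact: cvg_norm].
Unshelve. all: by end_near. Qed.

(** * A maximality principle, and the mean value theorem *)

(** A sequential form of the Brezis-Browder ordering principle.  The function [T]
    is a clock, bounded by [L], that can always be advanced before it reaches
    [L]; if increasing sequences have upper bounds, it reaches [L]. *)
Lemma exhaustion {R : realType} {S : Type} {le : S -> S -> Prop} {T : S -> R}
    {L : R} (p0 : S) :
  (forall p, le p p) ->
  (forall p q r, le p q -> le q r -> le p r) ->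
  (forall p q, le p q -> T p <= T q) ->
  (forall p, T p <= L) ->
  (forall u : nat -> S, (forall n, le (u n) (u n.+1)) ->
    exists q, forall n, le (u n) q) ->
  (forall p, T p < L -> exists2 q, le p q & T p < T q) ->
  exists2 q, le p0 q & T q = L.
Proof.
move=> lexx letr leT TL ubchain step.
pose up p := [set T q | q in le p].
have sup_up p : has_sup (up p).
  by split; [exists (T p), p|exists L => _ [q _ <-]; exact: TL].
(* every [p] has a successor that realizes half of the possible progress *)
have half p : exists q, le p q /\ (T p + sup (up p)) / 2 <= T q.
  have [supT|] := eqVneq (sup (up p)) (T p).
    by exists p; split => //; lra.
  rewrite neq_lt => /orP[|Tlt].
    by rewrite ltNge ub_le_sup //; [case: (sup_up p)|exists p].
  have gt0 : 0 < (sup (up p) - T p) / 2 by lra.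
  have [_ [q pq <-] Tq] := sup_adherent gt0 (sup_up p).
  by exists q; split => //; lra.
have [g gP] := choice half.
pose u n := iter n g p0.
have leu n : le (u n) (u n.+1) by have [] := gP (u n).
have [q uq] := ubchain u leu.
exists q; first exact: (uq 0).
apply/eqP; rewrite eq_le TL /= leNgt; apply/negP => /step[r qr Tqr].
have inc n : T (u n) + (T r - T q) / 2 <= T (u n.+1).
  have [_] := gP (u n); apply: le_trans.
  have : T r <= sup (up (u n)).
    by apply: ub_le_sup; [case: (sup_up (u n))|exists r => //; exact: letr (uq n) qr].
  have := leT _ _ (uq n); lra.
have grow n : T p0 + n%:R * ((T r - T q) / 2) <= T (u n).
  elim: n => [|n IH]; first by rewrite mul0r addr0.
  by apply: le_trans (inc n); rewrite -natr1 mulrDl mul1r addrA lerD2r.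
have dgt0 : 0 < (T r - T q) / 2 by lra.
have := truncnS_gt ((L - T p0) / ((T r - T q) / 2)).
rewrite ltr_pdivrMr // ltNge => /negP; apply.
by rewrite lerBrDl; exact: le_trans (grow _) (TL _).
Qed.

Lemma positive_lower_bound {R : realType} {I : eqType} {s : seq I} {r : I -> R} :
  (forall i, i \in s -> 0 < r i) ->
  exists2 rho, 0 < rho & forall i, i \in s -> rho <= r i.
Proof.
elim: s => [|a s IH] rs; first by exists 1.
have [|rho rho0 rhoP] := IH; first by move=> i si; apply: rs; rewrite inE si orbT.
exists (Num.min rho (r a)); first by rewrite lt_min rho0 rs // mem_head.
move=> i; rewrite inE => /predU1P[->|/rhoP rhoi]; first by rewrite ge_min lexx orbT.
by rewrite ge_min rhoi.
Qed.

Lemma gateaux_mean_value {R : realType} {E : normedModType R}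
    {f : E -> R} {f' : E -> dual E} :
  gateaux_derivative f f' -> forall x h (t : R), 0 <= t ->
  exists2 s, 0 <= s <= t & f (x + t *: h) - f x = t * f' (x + s *: h) h.
Proof.
move=> df x h t t0.
pose g s := f (x + s *: h).
have dg s : is_derive s (1 : R) g (f' (x + s *: h) h).
  have [ex val] := df (x + s *: h) h.
  have eqg : (fun k : R => k^-1 *: ((g \o shift s) (k *: 1) - g s)) =
      (fun k : R => k^-1 *: ((f \o shift (x + s *: h)) (k *: h) - f (x + s *: h))).
    by apply/funext => k; rewrite /g /= addrCA -scalerDl [k *: 1]mulr1.
  apply: DeriveDef; first by rewrite /derivable eqg.
  by rewrite -val /derive eqg.
have cg : {within `[0, t], continuous g}.
  apply: derivable_within_continuous => s _; exact: ex_derive.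
have [s sI] := MVT_segment t0 (fun s _ => dg s) cg.
rewrite /g scale0r addr0 subr0 mulrC => ->.
by exists s => //; move: sI; rewrite in_itv.
Qed.

(** * Local and global descent directions *)

(** The points at which a deformation has to descend: those at level [d] up to
    [e] that have a point of [F] within [e (1 + |y|)]. *)
Definition active_point {R : realType} {E : normedModType R} (f : E -> R)
    (d : R) (F : set E) (e : R) : set E :=
  [set y | `|f y - d| <= e /\ exists2 z, F z & `|z - y| <= e * (1 + `|y|)].

(** Halving [e] absorbs both the oscillation of [f] and the change of weight. *)
Lemma active_point_near {R : realType} {E : normedModType R} {f : E -> R}
    {d : R} {F : set E} {e : R} {x : E} :
  continuous f -> 0 < e <= 1 / 2 -> ~ active_point f d F e x ->
  \forall y \near x, ~ active_point f d F (e / 2) y.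
Proof.
move=> cf /andP[e0 e1] nact.
have fnear : \forall y \near x, `|f x - f y| < e / 2.
  by have /cvgrPdist_lt := cf x; apply; lra.
have xnear : \forall y \near x, `|x - y| < e / 4.
  by apply/nbhs_normP; exists (e / 4) => //=; lra.
apply: filterS2 fnear xnear => y fxy xy [fyd [z Fz zy]]; apply: nact; split.
  by have := ler_normD (f x - f y) (f y - d); rewrite addrA subrK; lra.
exists z => //.
have := ler_normD (z - y) (y - x); rewrite addrA subrK (distrC y).
have := ler_normD (y - x) x; rewrite subrK (distrC y).
have := normr_ge0 x.
nra.
Qed.

(** Around every point there are a direction [hr.1] and a radius [hr.2] such that
    [f] descends along the direction throughout the ball as soon as the ball
    contains an active point.  When the centre is not active for [e], no point of
    a small ball is active for [e / 2], and the direction is [0]. *)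
Lemma local_descent {R : realType} {E : normedModType R}
    {f : E -> R} {f' : E -> dual E} {d : R} {F : set E} {e : R} (x : E) :
  continuous f -> (forall v, continuous (fun x => f' x v : R)) ->
  0 < e <= 1 / 2 ->
  (forall x, active_point f d F e x ->
      exists2 h, `|h| <= (1 + `|x|) / 2 & f' x h < - (2 * e)) ->
  exists hr : E * R, 0 < hr.2 /\ forall y, `|x - y| < hr.2 ->
    [/\ `|hr.1| <= 1 + `|y|, `|f x - f y| < e / 8 &
      forall y', `|x - y'| < hr.2 -> active_point f d F (e / 2) y' ->
        f' y hr.1 <= - (2 * e)].
Proof.
move=> cf cf' /[dup] e01 /andP[e0 e1] desc.
have fnear : \forall y \near x, `|f x - f y| < e / 8.
  by have /cvgrPdist_lt := cf x; apply; lra.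
have [act|nact] := pselect (active_point f d F e x).
  have [h hx f'h] := desc x act.
  have f'near : \forall y \near x, f' y h <= - (2 * e).
    exact: (cvgr_le _ (cf' h x)).
  have hnear : \forall y \near x, `|h| <= 1 + `|y|.
    apply/nbhs_normP; exists (1 / 2) => [/=|y /= xy]; first by lra.
    apply: (le_trans hx).
    have := ler_normD (x - y) y; rewrite subrK; have := normr_ge0 x; lra.
  have /nbhs_normP[r /= r0 rP] : \forall y \near x,
      `|f x - f y| < e / 8 /\ f' y h <= - (2 * e) /\ `|h| <= 1 + `|y|.
    exact: filterI fnear (filterI f'near hnear).
  exists (h, r); split => //= y xy; have [? [? ?]] := rP y xy; split => //.
have := active_point_near cf e01 nact => nactnear.
have /nbhs_normP[r /= r0 rP] : \forall y \near x,
    `|f x - f y| < e / 8 /\ ~ active_point f d F (e / 2) y.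
  exact: filterI fnear nactnear.
exists (0, r); split => //= y xy; have [? _] := rP y xy; split => //.
  by rewrite normr0 addr_ge0.
by move=> y' /rP[_ +]; move=> /[apply].
Qed.

(** The local directions are averaged by a partition of unity subordinate to a
    finite cover of [K].  The resulting field is continuous on [E], is bounded by
    the weight, vanishes where [f] is low, and makes [f] descend at rate [2 e]
    from the points of [K] that are active for [e / 2], for all times up to a
    common [tau]. *)
Lemma descent_field {R : realType} {E : normedModType R}
    {f : E -> R} {f' : E -> dual E} {d : R} {F : set E} {e : R} {K : set E} :
  continuous f -> gateaux_derivative f f' ->
  (forall v, continuous (fun x => f' x v : R)) ->
  0 < e <= 1 / 2 ->
  (forall x, active_point f d F e x ->
      exists2 h, `|h| <= (1 + `|x|) / 2 & f' x h < - (2 * e)) ->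
  compact K ->
  exists H : E -> E, exists tau : R,
    [/\ 0 < tau, continuous H, forall y, `|H y| <= 1 + `|y|,
        forall y, f y <= d - e -> H y = 0 &
        forall y t, K y -> 0 <= t <= tau ->
          `|f (y + t *: H y) - f y| <= e / 4 /\
          (active_point f d F (e / 2) y ->
             f (y + t *: H y) <= f y - 2 * e * t)].
Proof.
move=> cf df cf' e01 desc cK.
have [hr hrP] := choice (fun x => local_descent x cf cf' e01 desc).
have /andP[e0 e1] := e01.
pose h x := (hr x).1; pose r x := (hr x).2.
have r0 x : 0 < r x by have [] := hrP x.
have hP x : forall y, `|x - y| < r x -> [/\ `|h x| <= 1 + `|y|, `|f x - f y| < e / 8 &
      forall y', `|x - y'| < r x -> active_point f d F (e / 2) y' ->
        f' y (h x) <= - (2 * e)] by have [] := hrP x.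
have [D _ KD] : finite_subset_cover K (fun x => ball x (r x / 4)) K.
  have := cK; rewrite compact_cover; apply.
    by move=> x _; exact: ball_open.
  by move=> x Kx; exists x => //; apply: ballxx; have := r0 x; lra.
pose s : seq E := D.
have cover y : K y -> exists2 i, i \in s & `|i - y| < r i / 4.
  by move=> /KD[i iD]; rewrite -ball_normE; exists i.
have [rho rho0 rhoP] := positive_lower_bound (s := s) (fun i _ => r0 i).
(* the weights live on balls of radius [r i / 2], whereas [K] is covered by the
   balls of radius [r i / 4], so their sum is at least [rho / 4] on [K] *)
pose w i y := Num.max 0 (r i / 2 - `|i - y|).
have w0 i y : 0 <= w i y by rewrite /w le_max lexx.
have wr i y : 0 < w i y -> `|i - y| < r i / 2 by rewrite /w lt_max ltxx subr_gt0.
pose W y := \sum_(i <- s) w i y.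
(* away from [K] the sum [W] may vanish; [N] is a positive denominator *)
pose N y := Num.max (W y) (rho / 4).
have N0 y : 0 < N y by rewrite /N lt_max; apply/orP; right; lra.
have W0 y : 0 <= W y by exact: sumr_ge0.
have NK y : K y -> N y = W y.
  move=> /cover[i si iy]; apply/max_idPl.
  rewrite /W (big_rem i) //= -[leLHS]addr0 lerD //; last exact: sumr_ge0.
  by rewrite /w le_max; apply/orP; right; have := rhoP i si; lra.
pose H0 y := (N y)^-1 *: \sum_(i <- s) w i y *: h i.
(* a cutoff that is [0] where [f <= d - e] and [1] where [f >= d - e / 2] *)
pose chi y := Num.min 1 (Num.max 0 ((f y - (d - e)) * (2 / e))).
have chi01 y : 0 <= chi y <= 1.
  by rewrite /chi le_min ge_min ler01 lexx le_max lexx.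
pose H y := chi y *: H0 y.
have cw i : continuous (w i).
  move=> y; apply: (@continuous_max R E (fun=> 0) (fun y => r i / 2 - `|i - y|)).
    exact: cst_continuous.
  apply: continuousB; first exact: cst_continuous.
  by apply: cvg_norm; apply: continuousB => //; exact: cst_continuous.
have cW : continuous W.
  by apply: continuous_big => [|i _]; [exact: add_continuous|exact: cw].
have cchi : continuous chi.
  move=> y; apply: (@continuous_min R E (fun=> 1)
      (fun y => Num.max 0 ((f y - (d - e)) * (2 / e)))).
    exact: cst_continuous.
  apply: (@continuous_max R E (fun=> 0) (fun y => (f y - (d - e)) * (2 / e))).
    exact: cst_continuous.
  apply: continuousM; last exact: cst_continuous.
  by apply: continuousB; [exact: cf|exact: cst_continuous].
have cH : continuous H.
  move=> y; apply: continuousZ; first exact: cchi.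
  apply: continuousZ.
    apply: continuousV; first by rewrite gt_eqF.
    by apply: (@continuous_max R E W (fun=> rho / 4)); [exact: cW|exact: cst_continuous].
  apply: cvg_big => [|i _]; first exact: add_continuous.
  by apply: cvgZr_tmp; exact: cw.
have H0norm y : `|H0 y| <= 1 + `|y|.
  rewrite normrZ gtr0_norm ?invr_gt0 // mulrC ler_pdivrMr //.
  apply: (@le_trans _ _ (W y * (1 + `|y|))); last first.
    by rewrite mulrC ler_wpM2l ?addr_ge0 // le_max lexx.
  apply: le_trans (ler_norm_sum _ _ _) _.
  rewrite mulr_suml; apply: ler_sum => i _; rewrite normrZ ger0_norm //.
  have := w0 i y; rewrite le_eqVlt => /predU1P[<-|]; first by rewrite !mul0r.
  move=> /[dup] /ltW wi0 /wr iy; rewrite ler_wpM2l //.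
  by have [] := hP i y _ => //; have := r0 i; lra.
have [M KM] : exists M, forall y, K y -> `|y| <= M.
  have [M [_ KM]] := compact_bounded cK.
  by exists (M + 1); apply: KM; rewrite ltrDl.
pose tau := Num.min 1 (rho / 4 / (1 + `|M|)).
have M1 : 0 < 1 + `|M| by rewrite ltr_pwDl.
have tau0 : 0 < tau by rewrite lt_min ltr01 !divr_gt0.
have Hnorm y : `|H y| <= 1 + `|y|.
  have /andP[chi0 chi1] := chi01 y.
  rewrite normrZ ger0_norm //; apply: le_trans (H0norm y).
  by rewrite ler_piMl.
have small y t : K y -> 0 <= t <= tau -> `|t *: H y| <= rho / 4.
  move=> Ky /andP[t0 ttau]; rewrite normrZ ger0_norm //.
  apply: (@le_trans _ _ (tau * (1 + `|M|))).
    rewrite ler_pM // (le_trans (Hnorm y)) // lerD2l.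
    exact: le_trans (KM y Ky) (ler_norm _).
  by rewrite -ler_pdivlMr // ge_min lexx orbT.
exists H, tau; split => //.
- move=> y fy; rewrite /H /chi (_ : Num.max _ _ = 0) ?min_r ?scale0r//.
  by apply/max_idPl; rewrite mulr_le0_ge0 ?divr_ge0 //; lra.
- move=> y t Ky /[dup] tI /andP[t0 ttau].
  have near_center i (s1 : R) : 0 <= s1 <= t -> i \in s ->
      `|i - y| < r i / 2 -> `|i - (y + s1 *: H y)| < r i.
    move=> /andP[s10 s1t] si iy.
    have := small y s1 Ky; rewrite s10 (le_trans s1t) // => /(_ isT).
    have := rhoP i si; have := ler_normB (i - y) (s1 *: H y).
    by rewrite opprD addrA; have := r0 i; lra.
  split.
    have [i si iy] := cover y Ky.
    have iy' : `|i - y| < r i by have := r0 i; lra.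
    have [_ fiy _] := hP i y iy'.
    have [||_ fiz _] := hP i (y + t *: H y) (near_center i t _ si _).
    + by rewrite t0 lexx.
    + by have := r0 i; lra.
    have := ler_distD (f i) (f (y + t *: H y)) (f y).
    by rewrite (distrC _ (f i)); lra.
  move=> act.
  have Hy : H y = H0 y.
    rewrite /H /chi min_l ?scale1r // le_max; apply/orP; right.
    have [fyd _] := act; move: fyd; rewrite ler_norml => /andP[fyd _].
    by rewrite mulrA ler_pdivlMr //; lra.
  have [s1 s1I] := gateaux_mean_value df y (H y) t t0.
  suff : f' (y + s1 *: H y) (H y) <= - (2 * e) by nra.
  set z := y + _.
  rewrite Hy linearZ /= linear_sum /= /GRing.scale /= mulrC.
  rewrite ler_pdivrMr // NK // mulrC mulr_suml big_seq [leRHS]big_seq.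
  apply: ler_sum => i si; rewrite linearZ /= /GRing.scale /=.
  have := w0 i y; rewrite le_eqVlt => /predU1P[<-|]; first by rewrite !mul0r.
  move=> /[dup] /ltW wi0 /wr iy; rewrite ler_wpM2l //.
  have [_ _] := hP i z (near_center i s1 s1I si iy); apply; last exact: act.
  by have := r0 i; lra.
Qed.

(** * Deformations *)

(** [within_cost x l y m] says that [y] can be reached from [x] between the times
    [l] and [m] at speed at most [(1 + |x|) / l].  Multiplicative time makes the
    relation transitive for every positive initial time, although the weight
    varies along the way. *)
Definition within_cost {R : realType} {E : normedModType R}
    (x : E) (l : R) (y : E) (m : R) : Prop :=
  l * `|y - x| <= (m - l) * (1 + `|x|).

Lemma within_cost_norm {R : realType} {E : normedModType R}
    {x y : E} {l m : R} : 0 <= l -> within_cost x l y m ->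
  l * (1 + `|y|) <= m * (1 + `|x|).
Proof.
rewrite /within_cost => l0 xy.
have := ler_normD (y - x) x; rewrite subrK => nyx.
have : l * `|y| <= l * (`|y - x| + `|x|) by rewrite ler_wpM2l.
lra.
Qed.

Lemma within_cost_trans {R : realType} {E : normedModType R}
    {x y z : E} {l m n : R} : 0 < l <= m -> m <= n ->
  within_cost x l y m -> within_cost y m z n -> within_cost x l z n.
Proof.
move=> /andP[l0 lm] mn xy yz.
have m0 : 0 < m by exact: lt_le_trans lm.
have nxy := within_cost_norm (ltW l0) xy.
have lzy : l * `|z - y| <= (n - m) * (1 + `|x|).
  rewrite -(ler_pM2l m0).
  apply: (@le_trans _ _ (l * ((n - m) * (1 + `|y|)))).
    by rewrite mulrCA ler_wpM2l // ltW.
  rewrite mulrCA [leRHS]mulrCA; apply: ler_wpM2l => //.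
  by rewrite subr_ge0.
have := ler_normD (z - y) (y - x); rewrite addrA subrK => nzx.
have : l * `|z - x| <= l * (`|z - y| + `|y - x|) by rewrite ler_wpM2l // ltW.
rewrite /within_cost in xy *; lra.
Qed.

Section Deformation.
Context {R : realType} {E : completeNormedModType R}.
Variables (f : E -> R) (d : R) (F : set E) (e L : R) (K : set E).

(** Some point of [F] can be reached from [x], starting at time [l], by the final
    time [L]. *)
Definition reaches_in_time (x : E) (l : R) : Prop :=
  exists2 z, F z & within_cost x l z L.

(** A deformation [p.1] run from time [1] until time [p.2].  It fixes the points
    where [f] is low.  At the points of [K] from which [F] can still be reached,
    it has brought [f] below a bound that decreases by [e] per unit of time,
    starting from [d + e ^+ 2 / 4].  Nothing is required of the other
    points of [K], since they cannot meet [F] any more. *)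
Definition partial_deformation (p : (E -> E) * R) : Prop :=
  [/\ continuous p.1, 1 <= p.2 <= L,
      forall x, f x <= d - e -> p.1 x = x &
      forall x, K x -> reaches_in_time (p.1 x) p.2 ->
        f (p.1 x) <= d + e ^+ 2 / 4 - e * (p.2 - 1)].

(** [q] is a later stage than [p], obtained by moving at the allowed speed. *)
Definition continues (p q : (E -> E) * R) : Prop :=
  p.2 <= q.2 /\ forall x, within_cost (p.1 x) p.2 (q.1 x) q.2.

Lemma continues_refl p : continues p p.
Proof. by split => // x; rewrite /within_cost !subrr normr0 mulr0 mul0r. Qed.

Lemma continues_trans {p q r} : 0 < p.2 ->
  continues p q -> continues q r -> continues p r.
Proof.
move=> p0 [pq pqx] [qr qrx]; split; first exact: le_trans qr.
by move=> x; apply: (within_cost_trans _ qr (pqx x) (qrx x)); rewrite p0.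
Qed.

(** The stages of an increasing sequence converge locally uniformly. *)
Lemma partial_deformation_chain (u : nat -> (E -> E) * R) :
  continuous f -> 0 < e <= 1 / 2 -> L <= 2 ->
  (forall n, partial_deformation (u n)) ->
  (forall n, continues (u n) (u n.+1)) ->
  exists q, partial_deformation q /\ forall n, continues (u n) q.
Proof.
move=> cf /andP[e0 e1] L2 uP ustep.
pose l n := (u n).2; pose eta n := (u n).1.
have l1 n : 1 <= l n <= L by have [] := uP n.
have l0 n : 0 < l n by have /andP[ln _] := l1 n; exact: lt_le_trans ltr01 ln.
have umono n m : (n <= m)%N -> continues (u n) (u m).
  move=> /subnK <-; elim: (m - n)%N => [|k IH]; first exact: continues_refl.
  exact: (continues_trans (l0 n) IH (ustep _)).
have lmono : {homo l : n m / (n <= m)%N >-> n <= m}.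
  by move=> n m /umono[].
pose linf := sup (range l).
have lub : has_ubound (range l) by exists L => _ [n _ <-]; have /andP[] := l1 n.
have lcvg : l n @[n --> \oo] --> linf by exact: nondecreasing_cvgn.
have lle n : l n <= linf by apply: ub_le_sup => //; exists n.
have linfL : linf <= L.
  by apply: ge_sup => [|_ [n _ <-]]; [exists (l 0), 0|have /andP[] := l1 n].
have linf1 : 1 <= linf by have /andP[h _] := l1 0; exact: le_trans (lle 0).
have lclose (del : R) : 0 < del -> exists n, linf - l n < del.
  move=> del0; have /cvgrPdist_lt /(_ _ del0)[n _ nP] := lcvg.
  by exists n; have := nP n (leqnn n); rewrite /= ger0_norm // subr_ge0.
have step n m x : (n <= m)%N ->
    l n * `|eta m x - eta n x| <= (linf - l n) * (1 + `|eta n x|).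
  move=> nm; have [_ /(_ x)] := umono n m nm; rewrite /within_cost -/(l n) -/(l m).
  move=> h; apply: (le_trans h); apply: ler_wpM2r; first by rewrite addr_ge0.
  by rewrite lerD2r.
have etan n x : 1 + `|eta n x| <= 2 * (1 + `|eta 0 x|).
  have [_ /(_ x)] := umono 0 n (leq0n n).
  move=> /(within_cost_norm (ltW (l0 0))); rewrite -/(l 0) -/(l n) -/(eta 0) -/(eta n).
  have /andP[l01 _] := l1 0; have /andP[_ lnL] := l1 n.
  have := normr_ge0 (eta 0 x); have := normr_ge0 (eta n x); nra.
have dist n m x : (n <= m)%N ->
    `|eta m x - eta n x| <= (linf - l n) * (2 * (1 + `|eta 0 x|)).
  move=> nm; have := step n m x nm; have /andP[ln1 _] := l1 n.
  have := etan n x; have := lle n; have := normr_ge0 (eta m x - eta n x).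
  have := normr_ge0 (eta n x).
  nra.
have etacvg x : exists y : E, eta n x @[n --> \oo] --> y.
  have C0 : 0 < 2 * (1 + `|eta 0 x|) by rewrite mulr_gt0 ?ltr_pwDl.
  suff /cvg_ex[y ?] : cvg (eta n x @[n --> \oo]) by exists y.
  apply/cauchy_cvgP/cauchyP => eps eps0.
  have [n ln] := lclose (eps / (2 * (1 + `|eta 0 x|))) (divr_gt0 eps0 C0).
  exists (eta n x); exists n => // m /= nm.
  rewrite -ball_normE /= distrC; apply: le_lt_trans (dist n m x nm) _.
  by rewrite -ltr_pdivlMr.
have [etainf etaP] := choice etacvg.
have lim_dist n x C : (forall m, (n <= m)%N -> `|eta m x - eta n x| <= C) ->
    `|etainf x - eta n x| <= C.
  move=> bnd; apply: (closed_cvg (fun y => `|y - eta n x| <= C) _ _ _ (etaP x)).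
    apply: (@closed_comp _ _ (fun y => `|y - eta n x|) [set y | y <= C]).
      move=> y _; apply: cvg_norm.
      by apply: cvgB; [exact: cvg_id|exact: cvg_cst].
    exact: closed_le.
  by exists n => // m /= nm; exact: bnd.
have dist_inf n x : `|etainf x - eta n x| <= (linf - l n) * (2 * (1 + `|eta 0 x|)).
  by apply: lim_dist => m; exact: dist.
have cont n : continues (u n) (etainf, linf).
  split=> [|x /=]; first exact: lle.
  rewrite /within_cost /= mulrC -ler_pdivlMr ?l0 //.
  apply: lim_dist => m nm; rewrite ler_pdivlMr ?l0 // mulrC.
  exact: step.
exists (etainf, linf); split => //; split => /=.
- move=> x; apply/cvgrPdist_lt => eps eps0.
  pose C := 2 + `|eta 0 x|.
  have C0 : 0 < C by rewrite ltr_pwDl.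
  have [n ln] := lclose (eps / (8 * C)) (divr_gt0 eps0 (mulr_gt0 (ltr0n _ 8) C0)).
  rewrite ltr_pdivlMr ?mulr_gt0 // in ln.
  have ceta k : continuous (eta k) by have [] := uP k.
  have near0 : \forall y \near x, `|eta 0 x - eta 0 y| < 1.
    by have /cvgrPdist_lt := ceta 0 x; apply.
  have nearn : \forall y \near x, `|eta n x - eta n y| < eps / 4.
    by have /cvgrPdist_lt := ceta n x; apply; lra.
  apply: filterS2 near0 nearn => y y0 yn.
  have dx := dist_inf n x; have dy := dist_inf n y.
  have ny : `|eta 0 y| <= 1 + `|eta 0 x|.
    have := ler_normD (eta 0 y - eta 0 x) (eta 0 x).
    by rewrite subrK (distrC (eta 0 y)); lra.
  have ll := lle n.
  have dx' : `|etainf x - eta n x| <= (linf - l n) * (2 * C).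
    apply: (le_trans dx); apply: ler_wpM2l; first by rewrite subr_ge0.
    by rewrite /C; lra.
  have dy' : `|etainf y - eta n y| <= (linf - l n) * (2 * C).
    apply: (le_trans dy); apply: ler_wpM2l; first by rewrite subr_ge0.
    by rewrite /C; lra.
  have := ler_distD (eta n x) (etainf x) (etainf y).
  have := ler_distD (eta n y) (eta n x) (etainf y).
  by rewrite (distrC (eta n y) (etainf y)); lra.
- by rewrite linf1.
- move=> x fx; apply: (cvg_unique _ (etaP x)) => //.
  have -> : (fun n => eta n x) = (fun=> x).
    by apply/funext => n; have [_ _ fixn _] := uP n; exact: fixn.
  exact: cvg_cst.
- move=> x Kx [z Fz nearz].
  have bound n : f (eta n x) <= d + e ^+ 2 / 4 - e * (l n - 1).
    have [_ _ _] := uP n; apply => //.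
    exists z => //; have [_ /(_ x) cn] := cont n.
    by apply: within_cost_trans cn nearz => //; rewrite l0 lle.
  have cvgl : f (eta n x) + e * (l n - 1) @[n --> \oo]
      --> f (etainf x) + e * (linf - 1).
    apply: cvgD; first exact: (continuous_cvg _ (cf _) (etaP x)).
    by apply: cvgMr; apply: cvgB => //; exact: cvg_cst.
  rewrite lerBrDr.
  apply: (closed_cvg (fun y => y <= d + e ^+ 2 / 4) _ _ _ cvgl).
    exact: closed_le.
  by apply: nearW => n; rewrite -lerBrDr.
Qed.

(** A partial deformation can be continued as long as the final time has not been
    reached: one follows the descent field of the compact set [p.1 @` K]. *)
Lemma partial_deformation_step (f' : E -> dual E) (p : (E -> E) * R) :
  continuous f -> gateaux_derivative f f' ->
  (forall v, continuous (fun x => f' x v : R)) ->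
  0 < e <= 1 / 2 -> L <= 1 + e / 2 ->
  (forall x, active_point f d F e x ->
      exists2 h, `|h| <= (1 + `|x|) / 2 & f' x h < - (2 * e)) ->
  compact K ->
  partial_deformation p -> p.2 < L ->
  exists2 q, partial_deformation q & continues p q /\ p.2 < q.2.
Proof.
move=> cf df cf' e01 Le desc cK [cp /andP[p1 _] pfix pK] pL.
have /andP[e0 e1] := e01.
have cpK : compact (p.1 @` K).
  by apply: continuous_compact cK; exact: continuous_subspaceT.
have [H [tau [tau0 cH normH H0 Hdesc]]] :=
  descent_field cf df cf' e01 desc cpK.
(* [p.2 <= 2], so following the field for a time [s / 2] costs at most [s] *)
pose s := Num.min (L - p.2) (2 * tau).
have s0 : 0 < s by rewrite lt_min subr_gt0 pL mulr_gt0.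
have sL : s <= L - p.2 by rewrite ge_min lexx.
have stau : s <= 2 * tau by rewrite ge_min lexx orbT.
pose q : (E -> E) * R := (fun x => p.1 x + (s / 2) *: H (p.1 x), p.2 + s).
have pq x : within_cost (p.1 x) p.2 (q.1 x) q.2.
  rewrite /within_cost /q /= [p.1 x + _]addrC addrK [p.2 + s]addrC addrK.
  rewrite normrZ ger0_norm; last by rewrite divr_ge0 // ltW.
  have -> : p.2 * (s / 2 * `|H (p.1 x)|) = s * (p.2 / 2 * `|H (p.1 x)|) by ring.
  rewrite ler_pM2l //; apply: le_trans (normH _).
  by rewrite ler_piMl //; lra.
exists q; last by split; [split; rewrite //= lerDl ltW|rewrite /= ltrDl].
split.
- move=> x; apply: cvgD; first exact: cp.
  apply: cvgZl_tmp; apply: (@continuous_comp _ _ _ p.1 H); first exact: cp.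
  exact: cH.
- by rewrite /=; apply/andP; split; lra.
- by move=> x fx /=; rewrite pfix // H0 // scaler0 addr0.
- move=> x Kx [z Fz qz].
  have pz : within_cost (p.1 x) p.2 z L.
    apply: within_cost_trans (pq x) qz; last by rewrite /=; lra.
    by rewrite /= lerDl (ltW s0) andbT; exact: lt_le_trans p1.
  have fpx : f (p.1 x) <= d + e ^+ 2 / 4 - e * (p.2 - 1).
    by apply: pK => //; exists z.
  have [|fosc factive] := Hdesc (p.1 x) (s / 2) (ex_intro2 _ _ x Kx erefl).
    by apply/andP; split; lra.
  have [/factive fq|nact] := pselect (active_point f d F (e / 2) (p.1 x)).
    rewrite /=; apply: (le_trans fq); lra.
  have dist : exists2 z, F z & `|z - p.1 x| <= e / 2 * (1 + `|p.1 x|).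
    exists z => //; move: pz; rewrite /within_cost.
    have := normr_ge0 (z - p.1 x); have := normr_ge0 (p.1 x); nra.
  (* an inactive point from which [F] can be reached is low, and the
     oscillation bound keeps it low *)
  have low : f (p.1 x) < d - e / 2.
    rewrite ltNge; apply/negP => low; apply: nact; split => //.
    by rewrite ler_norml; apply/andP; split; nra.
  rewrite /=; move: fosc; rewrite ler_norml => /andP[_ fosc].
  have : e * (p.2 + s - 1) <= e * (e / 2) by rewrite ler_pM2l //; lra.
  have : e * (e / 2) <= e * (1 / 4) by rewrite ler_pM2l //; lra.
  have := sqr_ge0 e.
  lra.
Qed.

End Deformation.

(** At the final time [L], reaching [F] means belonging to [F], and the value of
    [f] has been brought there below [d + e ^+ 2 / 4 - e (L - 1) = d - e ^+ 2 / 4]. *)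
Lemma deformation {R : realType} {E : completeNormedModType R}
    {f : E -> R} {f' : E -> dual E} {d : R} {F : set E} {e : R} {K : set E} :
  continuous f -> gateaux_derivative f f' ->
  (forall v, continuous (fun x => f' x v : R)) ->
  0 < e <= 1 / 2 ->
  (forall x, active_point f d F e x ->
      exists2 h, `|h| <= (1 + `|x|) / 2 & f' x h < - (2 * e)) ->
  compact K -> (forall x, K x -> f x <= d + e ^+ 2 / 4) ->
  exists eta : E -> E, [/\ continuous eta,
    forall x, f x <= d - e -> eta x = x &
    forall x, K x -> F (eta x) -> f (eta x) < d].
Proof.
move=> cf df cf' e01 desc cK Kf.
have /andP[e0 e1] := e01.
pose L := 1 + e / 2.
pose S := {p | partial_deformation f d F e L K p}.
have id0 : partial_deformation f d F e L K (id, 1).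
  split => //=.
  - by move=> x; exact: cvg_id.
  - by rewrite lexx /L lerDl divr_ge0 // ltW.
  - by move=> x Kx _; rewrite subrr mulr0 subr0; exact: Kf.
have S1 (p : S) : 1 <= (sval p).2 by have [_ /andP[]] := svalP p.
have S0 (p : S) : 0 < (sval p).2 by exact: lt_le_trans ltr01 (S1 p).
have [||||||[q /= [cq _ qfix qK]] _ qL] :=
  @exhaustion R S (fun p q => continues (sval p) (sval q))
    (fun p => (sval p).2) L (exist _ _ id0).
- by move=> p; exact: continues_refl.
- by move=> p q r; exact: (continues_trans (S0 p)).
- by move=> p q [].
- by move=> p; have [_ /andP[]] := svalP p.
- move=> u ustep.
  have [|q [qP uq]] := partial_deformation_chain _ _ _ _ _ _ (fun n => sval (u n)) cf e01 _ (fun n => svalP (u n)) ustep.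
    by rewrite /L; lra.
  by exists (exist _ q qP).
- move=> p pL.
  have [q qP [pq lt]] := partial_deformation_step _ _ _ _ _ _ f' (sval p) cf df cf' e01 (lexx _) desc cK (svalP p) pL.
  by exists (exist _ q qP).
exists q.1; split => // x Kx Fx.
rewrite /= in qL.
have /(qK x Kx) : reaches_in_time F L (q.1 x) q.2.
  by exists (q.1 x) => //; rewrite /within_cost qL !subrr normr0 mulr0 mul0r.
rewrite qL /L => /le_lt_trans; apply.
have : 0 < e ^+ 2 by rewrite exprn_gt0.
rewrite expr2; lra.
Qed.

(** * Paths and the minimax level *)

Lemma path_crosses {R : realType} {E : normedModType R} {V : set E} {x y : E}
    {c : R -> E} : open V -> V x -> ~ closure V y -> paths x y c ->
  exists2 t, t \in `[0, 1] & (closure V `\` V) (c t).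
Proof.
move=> oV Vx Vy [cc c0 c1]; apply: contrapT => nocross.
have conn : connected (c @` `[0, 1]).
  by apply: connected_continuous_connected => //; exact: segment_connected.
have I0 : (c @` `[0, 1]) x by exists 0; rewrite //= in_itv /= lexx ler01.
have I1 : (c @` `[0, 1]) y by exists 1; rewrite //= in_itv /= lexx ler01.
have eqV : (c @` `[0, 1]) `&` V = (c @` `[0, 1]) `&` closure V.
  apply/seteqP; split=> [z [cz Vz]|z [[t tI <-] clz]].
    by split => //; exact: subset_closure.
  split; first by exists t.
  by apply: contrapT => nV; apply: nocross; exists t.
have : (c @` `[0, 1]) `&` V = c @` `[0, 1].
  apply: conn; first by exists x.
    by exists V.
  by exists (closure V) => //; exact: closed_closure.
by move=> /seteqP[_ /(_ y I1) [_ /subset_closure]].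
Qed.

Lemma path_max {R : realType} {E : normedModType R} {f : E -> R} {x y : E}
    {c : R -> E} : continuous f -> paths x y c ->
  exists2 t, t \in `[0, 1] & sup [set f (c t) | t in `[0, 1]] = f (c t) /\
    forall s, s \in `[0, 1] -> f (c s) <= f (c t).
Proof.
move=> cf [cc _ _].
have cfc : {within `[0, 1], continuous (f \o c)}.
  by apply: within_continuous_comp => // z _; exact: cf.
have [t tI tmax] := EVT_max ler01 cfc.
exists t => //; split => //; apply/eqP; rewrite eq_le; apply/andP; split.
  by apply: ge_sup => [|_ [s /= sI <-]]; [exists (f (c t)), t|exact: tmax].
apply: ub_le_sup; last by exists t.
by exists (f (c t)) => _ [s /= sI <-]; exact: tmax.
Qed.

Lemma segment_path {R : realType} {E : normedModType R} (x y : E) :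
  paths x y (fun t => x + t *: (y - x)).
Proof.
split; last 2 first.
- by rewrite scale0r addr0.
- by rewrite scale1r addrC subrK.
apply: continuous_subspaceT => t.
apply: cvgD; first exact: cvg_cst.
by apply: cvgZr_tmp; exact: cvg_id.
Qed.

Lemma minimax_level_le {R : realType} {E : normedModType R} {f : E -> R}
    {x y : E} {c : R -> E} : continuous f -> paths x y c ->
  exists2 t, t \in `[0, 1] & minimax_level f x y <= f (c t).
Proof.
move=> cf pc; have [t tI [supt _]] := path_max cf pc.
exists t => //; rewrite -supt; apply: ge_inf; last by exists c.
exists (f x) => _ [c' pc' <-].
have [t' _ [-> tmax]] := path_max cf pc'.
by have [_ <- _] := pc'; apply: tmax; rewrite in_itv /= lexx ler01.
Qed.

Lemma minimax_level_lt {R : realType} {E : normedModType R} {f : E -> R}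
    {x y : E} {b : R} : continuous f -> minimax_level f x y < b ->
  exists2 c, paths x y c & forall t, t \in `[0, 1] -> f (c t) < b.
Proof.
move=> cf /inf_lt[|_ [c pc <-] cb].
  by eexists; exists (fun t => x + t *: (y - x)) => //; exact: segment_path.
exists c => // t tI; have [t' _ [supt tmax]] := path_max cf pc.
by apply: le_lt_trans (tmax t tI) _; rewrite -supt.
Qed.

(** * The separation form of the mountain-pass theorem *)

Lemma minimax_separation {R : realType} {E : completeNormedModType R}
    {f : E -> R} {f' : E -> dual E} {u0 u1 : E} {F : set E} :
  let d := minimax_level f u0 u1 in
  continuous f -> gateaux_derivative f f' ->
  continuous (f' : E -> weak_star_dual E) ->
  conditionC f f' d -> f u0 < d -> f u1 < d ->
  closed F -> (forall x, F x -> d <= f x) ->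
  (forall c, paths u0 u1 c -> exists2 t, t \in `[0, 1] & F (c t)) ->
  exists2 x, F x & Cr f f' d x.
Proof.
move=> d cf df cf' fC fu0 fu1 clF Fd cross; apply: contrapT => noCr.
have cfv v := weak_star_continuous_eval v cf'.
(* small enough for the deformation to fix the end points *)
pose e0 := Num.min (1 / 2) (Num.min (d - f u0) (d - f u1)).
have e00 : 0 < e0 by rewrite !lt_min !subr_gt0 fu0 fu1 divr_gt0.
have [|e /andP[e_gt0 ee0] desc] := uniform_descent fC clF _ e00.
  by move=> x Fx Crx; apply: noCr; exists x.
move: ee0; rewrite !le_min => /and3P[e1 eu0 eu1].
have e01 : 0 < e <= 1 / 2 by rewrite e_gt0.
have e2 : 0 < e ^+ 2 / 4 by rewrite divr_gt0 // exprn_gt0.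
have [|c pc cd] := @minimax_level_lt _ _ f u0 u1 (d + e ^+ 2 / 4) cf.
  by rewrite ltrDl.
have [cc c0 c1] := pc.
have cK : compact (c @` `[0, 1]).
  by apply: continuous_compact => //; exact: segment_compact.
have [| |eta [ceta etafix etaF]] := @deformation _ _ f f' d F e _ cf df cfv e01 _ cK.
- by move=> x [fx [z Fz zx]]; exact: desc fx Fz zx.
- by move=> _ [t tI <-]; rewrite ltW // cd.
have [|t tI Ft] := cross (eta \o c).
  split => /=.
  - by apply: within_continuous_comp => // z _; exact: ceta.
  - by rewrite c0 etafix //; lra.
  - by rewrite c1 etafix //; lra.
have := etaF (c t) (ex_intro2 _ _ t tI erefl) Ft.
by rewrite ltNge Fd.
Qed.

(** * Path components *)

(** A path continuous on [[0, 1]] extends to a continuous function on [R]. *)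
Lemma continuous_clamp {R : realType} {T : topologicalType} {c : R -> T} :
  {within `[0, 1], continuous c} ->
  continuous (fun t : R => c (Num.min 1 (Num.max 0 t))).
Proof.
move=> cc t.
pose cl (s : R) := Num.min 1 (Num.max 0 s).
have clI s : `[0, 1]%classic (cl s).
  by rewrite /= in_itv /= /cl le_min ge_min ler01 lexx le_max lexx.
have ccl : {for t, continuous cl}.
  apply: (@continuous_min R R (fun=> 1) (fun s => Num.max 0 s)).
    exact: cst_continuous.
  apply: (@continuous_max R R (fun=> 0) id); first exact: cst_continuous.
  exact: cvg_id.
move/subspace_continuousP : cc => /(_ _ (clI t)) cc P nP.
have nclt : nbhs (cl t) (fun s => `[0, 1]%classic s -> P (c s)) := cc P nP.
have nt : nbhs t (fun s => `[0, 1]%classic (cl s) -> P (c (cl s))) := ccl _ nclt.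
by have : nbhs t (fun s => P (c (cl s))); [apply: filterS nt => s; exact|].
Qed.

Lemma joined_in_trans {R : realType} {E : normedModType R} {A : set E}
    {x y z : E} : joined_in A x y -> joined_in A y z -> joined_in A x z.
Proof.
move=> [a [ca a0 a1] aA] [b [cb b0 b1] bA].
pose cl (s : R) := Num.min 1 (Num.max 0 s).
have cl0 s : s <= 0 -> cl s = 0 by move=> s0; rewrite /cl max_l // min_r.
have cl1 s : 1 <= s -> cl s = 1.
  by move=> s1; rewrite /cl max_r ?min_l // (le_trans ler01).
have clI s : `[0, 1]%classic (cl s).
  by rewrite /= in_itv /= /cl le_min ge_min ler01 lexx le_max lexx.
(* each of the two halves of the path is stationary at [y] during the other *)
pose c t := a (cl (2 * t)) + (b (cl (2 * t - 1)) - y).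
have cleft t : t <= 1 / 2 -> c t = a (cl (2 * t)).
  by move=> t2; rewrite /c (cl0 (2 * t - 1)) ?b0 ?subrr ?addr0 //; lra.
have cright t : 1 / 2 <= t -> c t = b (cl (2 * t - 1)).
  by move=> t2; rewrite /c (cl1 (2 * t)) ?a1 1?addrC ?subrK //; lra.
exists c.
  split.
  - apply: continuous_subspaceT => t; apply: cvgD.
      apply: (@continuous_comp R R E (fun t => 2 * t) (a \o cl) t).
        by apply: cvgMr; exact: cvg_id.
      exact: continuous_clamp.
    apply: cvgB; last exact: cvg_cst.
    apply: (@continuous_comp R R E (fun t => 2 * t - 1) (b \o cl) t).
      by apply: cvgB; [apply: cvgMr; exact: cvg_id|exact: cvg_cst].
    exact: continuous_clamp.
  - by rewrite cleft ?cl0 ?a0 //; lra.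
  - by rewrite cright ?cl1 ?b1 //; lra.
move=> _ [t _ <-]; have [t2|/ltW t2] := leP t (1 / 2).
  by rewrite cleft //; apply: aA; exists (cl (2 * t)).
by rewrite cright //; apply: bA; exists (cl (2 * t - 1)).
Qed.

Lemma joined_in_sub {R : realType} {E : normedModType R} {A B : set E}
    {x y : E} : A `<=` B -> joined_in A x y -> joined_in B x y.
Proof. by move=> AB [c pc cA]; exists c => //; exact: subset_trans AB. Qed.

Lemma joined_in_ball {R : realType} {E : normedModType R} {A : set E}
    {x a b : E} {r : R} : (forall z, `|x - z| < r -> A z) ->
  `|x - a| < r -> `|x - b| < r -> joined_in A a b.
Proof.
move=> rA xa xb; exists (fun t => a + t *: (b - a)); first exact: segment_path.
move=> _ [t /= tI <-]; move: tI; rewrite in_itv /= => /andP[t0 t1]; apply: rA.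
have -> : x - (a + t *: (b - a)) = (1 - t) *: (x - a) + t *: (x - b).
  rewrite [(1 - t) *: _]scalerBl scale1r -[RHS]addrA [- _ + _]addrC -scalerBr.
  by rewrite opprB [x - b + _]addrC addrA subrK opprD addrA -scalerN opprB.
apply: le_lt_trans (ler_normD _ _) _; rewrite !normrZ.
rewrite !ger0_norm ?subr_ge0 //.
have [t12|t12] := leP t (1 / 2); nra.
Qed.

Lemma open_norm_ball {R : realType} {E : normedModType R} {A : set E} {x : E} :
  open A -> A x -> exists2 r : R, 0 < r & forall z, `|x - z| < r -> A z.
Proof.
move=> oA Ax; have /nbhs_normP[r /= r0 rA] : \forall z \near x, A z.
  exact: open_nbhs_nbhs.
by exists r.
Qed.

Lemma path_component_sub {R : realType} {E : normedModType R} {A : set E}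
    {e : E} : path_component A e `<=` A.
Proof.
by move=> x [c [_ _ c1] cA]; apply: cA; exists 1; rewrite //= in_itv /= lexx ler01.
Qed.

Lemma path_component_refl {R : realType} {E : normedModType R} {A : set E}
    {e : E} : A e -> path_component A e e.
Proof.
move=> Ae; exists (fun=> e) => [|_ [t _ <-] //].
by split => //; apply: continuous_subspaceT => t; exact: cvg_cst.
Qed.

Lemma open_path_component {R : realType} {E : normedModType R} {A : set E}
    {e : E} : open A -> open (path_component A e).
Proof.
move=> oA; rewrite openE => x ex.
have [r r0 rA] := open_norm_ball oA (path_component_sub _ ex).
apply/nbhs_normP; exists r => //= z xz.
apply: (joined_in_trans ex); apply: (joined_in_ball rA) => //.
by rewrite subrr normr0.
Qed.

(** A path component of an open set [A] is relatively closed in [A]. *)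
Lemma path_component_closure {R : realType} {E : normedModType R} {A : set E}
    {e x : E} : open A -> A x -> closure (path_component A e) x ->
  path_component A e x.
Proof.
move=> oA Ax clx.
have [r r0 rA] := open_norm_ball oA Ax.
have [|z [ez xz]] := clx [set z | `|x - z| < r].
  by apply/nbhs_normP; exists r.
apply: (joined_in_trans ez); apply: (joined_in_ball rA) => //.
by rewrite subrr normr0.
Qed.

(** * The structure of the critical set *)

Lemma open_shrink {R : realType} {E : normedModType R} {K W : set E} :
  closed K -> open W -> K `<=` W ->
  exists N, [/\ open N, K `<=` N & closure N `<=` W].
Proof.
move=> clK oW KW.
have nE : normal_space E by exact: (@pseudometric_normal R E).
have [|U [V [oU oV KU WV UV]]] := (@normal_openP R E).1 nE K (~` W) clK (open_closedC oW).
  by rewrite -subset0 => x [/KW Wx]; apply.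
exists U; split => // x clx; apply: contrapT => /WV Vx.
have [z [Uz Vz]] := clx V (open_nbhs_nbhs (conj oV Vx)).
by have : (U `&` V) z by []; rewrite UV.
Qed.

Theorem theorem1p2 (R : realType) (E : completeNormedModType R)
    (f : E -> R) (f' : E -> dual E) (u0 u1 : E) (d : R)
    (f_continuous : continuous f)
    (f_gateaux : gateaux_derivative f f')
    (f'_continuous : continuous (f' : E -> weak_star_dual E))
    (u0_neq_u1 : u0 <> u1)
    (d_def : d = minimax_level f u0 u1)
    (f_C : conditionC f f' d)
    (d_gt : Num.max (f u0) (f u1) < d) :
  exists ubar : E,
    [/\ Cr f f' d ubar,
        reaches f d u0 ubar &
        mountain_pass_point f f' ubar \/
        (closure (Mmin f f' d) `\` Mmin f f' d) ubar].
Proof.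
apply: contrapT => none.
move: d_gt; rewrite gt_max => /andP[fu0 fu1].
pose S := sublevel f d; pose A := path_component S u0.
have oS : open S.
  apply: (@open_comp _ _ f [set y | y < d]) => [x _|]; last exact: open_lt.
  exact: f_continuous.
have oA : open A by exact: open_path_component.
have SclA x : S x -> closure A x -> A x by exact: path_component_closure.
have Au1 : ~ A u1.
  move=> [c pc cS]; have [t tI] := minimax_level_le f_continuous pc.
  by rewrite -d_def leNgt; have -> : f (c t) < d by apply: cS; exists t.
(* a point at level [d] adherent to [A] is a limit of points of lower level *)
have nearby u : closure A u -> f u = d -> ~ Mmin f f' d u.
  move=> clu fud [_ minu].
  have [v [Av]] := clu _ minu.
  by rewrite fud leNgt; have -> : f v < d by exact: (path_component_sub _ Av).
pose K := Cr f f' d `&` closure A.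
have clK : closed K.
  apply: closedI; last exact: closed_closure.
  have -> : Cr f f' d = f @^-1` [set d] `&`
      \bigcap_(v in [set: E]) ((fun x => f' x v : R) @^-1` [set 0]).
    apply/seteqP; split=> [x [fx f'x]|x [fx f'x]].
      by split=> // v _; exact: f'x.
    by split=> // v; exact: f'x.
  apply: closedI.
    apply: closed_comp => [x _|]; first exact: f_continuous.
    exact: closed_eq.
  apply: closed_bigI => v _; apply: closed_comp => [x _|].
    exact: weak_star_continuous_eval.
  exact: closed_eq.
(* the last condition keeps [u1] out of [W] and hence out of [closure N] *)
pose good U := [/\ open U, forall v, U v -> ~ Mmin f f' d v,
  U `&` S `<=` A & forall v, U v -> f u1 < f v].
pose W := \bigcup_(U in good) U.
have KW : K `<=` W.
  move=> u [Cru clu]; have [fud critu] := Cru.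
  have nM := nearby u clu fud.
  have nclM : ~ closure (Mmin f f' d) u.
    by move=> clM; apply: none; exists u; split => //; right.
  have [U oU [Uu [USe pcU]]] : exists2 U, open U & U u /\
      (U `&` S !=set0 /\ path_connected (U `&` S)).
    apply: contrapT => noU; apply: none; exists u; split => //; left.
    split => // U oU Uu; rewrite fud; split.
      have [v [Av Uv]] := clu U (open_nbhs_nbhs (conj oU Uu)).
      by exists v; split => //; exact: (path_component_sub _ Av).
    move=> pcU; apply: noU; exists U => //; split => //; split => //.
    have [v [Av Uv]] := clu U (open_nbhs_nbhs (conj oU Uu)).
    by exists v; split => //; exact: (path_component_sub _ Av).
  have USA : U `&` S `<=` A.
    have [a [Aa Ua]] := clu U (open_nbhs_nbhs (conj oU Uu)).
    move=> v USv; apply: (joined_in_trans Aa).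
    apply: (@joined_in_sub _ _ (U `&` S)); first by move=> ? [].
    by apply: pcU => //; split => //; exact: (path_component_sub _ Aa).
  pose U' := U `&` ~` closure (Mmin f f' d) `&` f @^-1` [set y | f u1 < y].
  have U'u : U' u by split; [split|rewrite /= fud].
  suff goodU' : good U' by exists U'.
  split.
  - apply: openI.
      by apply: openI => //; apply: closed_openC; exact: closed_closure.
    apply: open_comp; first by move=> x _; exact: f_continuous.
    exact: open_gt.
  - by move=> v [[_ nclv] _] Mv; apply: nclv; exact: subset_closure.
  - by move=> v [[[Uv _] _] Sv]; exact: USA.
  - by move=> v [_].
have oW : open W by apply: bigcup_open => U [].
have [N [oN KN NW]] := open_shrink clK oW KW.
pose V := A `|` N.
have oV : open V by exact: openU.
have clV x : closure V x -> closure A x \/ closure N x by rewrite closureU.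
have Vu1 : ~ closure V u1.
  move=> /clV[/SclA|/NW[U [_ _ _ Ulow] /Ulow]]; last by rewrite ltxx.
  by move=> /(_ fu1).
have Au0 : A u0 by exact: path_component_refl.
(* a point of [W] with [f x < d] belongs to [A] *)
have levelV x : (closure V `\` V) x -> d <= f x.
  move=> [clx nVx]; rewrite leNgt; apply/negP => fx; apply: nVx; left.
  have [/SclA|/NW[U [_ _ US _] Ux]] := clV x clx; first exact.
  by apply: US.
have clF : closed (closure V `\` V).
  by apply: closedI; [exact: closed_closure|exact: open_closedC].
have [x [clx nVx] Crx] : exists2 x, (closure V `\` V) x & Cr f f' d x.
  have := @minimax_separation _ _ f f' u0 u1 (closure V `\` V).
  rewrite /= -d_def; apply => //.
  by move=> c; apply: path_crosses => //; left.
have nclA : ~ closure A x by move=> clA; apply: nVx; right; apply: KN.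
have [//|/NW[U [oU UM US _] Ux]] := clV x clx.
apply: (UM x Ux); split => //.
have : nbhs x (U `&` ~` closure A).
  apply: open_nbhs_nbhs; split => //.
  by apply: openI => //; apply: closed_openC; exact: closed_closure.
apply: filterS => v [Uv nclv]; have [-> _] := Crx.
rewrite leNgt; apply/negP => fv; apply: nclv.
by apply: subset_closure; apply: US.
Qed.
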